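(* Let $a\le -1$ be an integer. Define $a_{\mathcal{G}}(n)$, $n\ge0$, by $a_{\mathcal{G}}(0)=1$, $a_{\mathcal{G}}(1)=-1$, $a_{\mathcal{G}}(2)=a$ and, for $n\ge3$, $$a_{\mathcal{G}}(n)=-\frac12\left(\sum_{k=0}^{n-2}a_{\mathcal{G}}(k)\binom{n-1}{k}2^{n-1-k}+\sum_{k=0}^{n-1}a_{\mathcal{G}}(k)\binom{n}{k}2^{n-k}\right).$$ For integers $0\le j\le d$ set $c_{\mathcal{G}}(j,d)=\sum_{k=j}^d2^{-k}\binom{d-j}{d-k}a_{\mathcal{G}}(k)$. Then for all $d\ge0$ and $0\le j\le d$, $c_{\mathcal{G}}(j,d)=(-1)^dc_{\mathcal{G}}(d-j,d)$. *)

(* Defs.v *)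
From mathcomp Require Import all_boot all_order all_algebra.
Set Implicit Arguments.
Unset Strict Implicit.
Unset Printing Implicit Defensive.
Import Order.TTheory GRing.Theory Num.Theory.
Local Open Scope ring_scope.

(* The sequence a_G is defined by course-of-values recursion: [aG_next a s] is
   the value a_G(n) computed from the table s = [:: a_G(0); ...; a_G(n-1)].
   Lemmas [aG0], [aG1], [aG2] and [aG_rec] are the defining equations. *)
Definition aG_next (a : int) (s : seq rat) : rat :=
  match size s with
  | 0%N => 1
  | 1%N => -1
  | 2%N => a%:~R
  | n => - (1 / 2) *
      (\sum_(0 <= k < n.-1) s`_k * 'C(n.-1, k)%:R * 2 ^+ (n.-1 - k) +
       \sum_(0 <= k < n) s`_k * 'C(n, k)%:R * 2 ^+ (n - k))
  end.

Definition aG_table (a : int) (n : nat) : seq rat :=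
  iter n (fun s => rcons s (aG_next a s)) [::].

Definition aG (a : int) (n : nat) : rat := aG_next a (aG_table a n).

Lemma size_aG_table a n : size (aG_table a n) = n.
Proof. by elim: n => //= n IHn; rewrite size_rcons IHn. Qed.

Lemma nth_aG_table a n k : (k < n)%N -> (aG_table a n)`_k = aG a k.
Proof.
elim: n => //= n IHn; rewrite ltnS leq_eqVlt nth_rcons size_aG_table.
by case/predU1P => [->|lt_kn]; rewrite ?ltnn ?eqxx // lt_kn IHn.
Qed.

Lemma aG0 a : aG a 0 = 1. Proof. by []. Qed.

Lemma aG1 a : aG a 1 = -1. Proof. by []. Qed.

Lemma aG2 a : aG a 2 = a%:~R. Proof. by []. Qed.

Lemma aG_rec a n : (3 <= n)%N ->
  aG a n = - (1 / 2) *
    (\sum_(0 <= k < n.-1) aG a k * 'C(n.-1, k)%:R * 2 ^+ (n.-1 - k) +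
     \sum_(0 <= k < n) aG a k * 'C(n, k)%:R * 2 ^+ (n - k)).
Proof.
case: n => [|[|[|n]]] // _; rewrite {1}/aG /aG_next size_aG_table.
congr (_ * (_ + _)); apply: eq_big_nat => k /andP[_ lt_kn];
  by rewrite nth_aG_table // (leq_trans lt_kn) //= leqW.
Qed.

Definition cG (a : int) (j d : nat) : rat :=
  \sum_(j <= k < d.+1) 2 ^- k * 'C(d - j, d - k)%:R * aG a k.

(* Main.v *)
Require Import Defs.
From HB Require Import structures.
From mathcomp Require Import all_boot all_order all_algebra.
From mathcomp Require Import ring lra.
Import Order.TTheory GRing.Theory Num.Theory.
Local Open Scope ring_scope.

(** Put b_k = a_G(k) / 2^k and let L be the linear functional on polynomials
    with L(X^k) = b_k. Then c_G(j, d) = L(X^j (1 + X)^(d - j)), and the claim is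
    that L is invariant under the involution X |-> -1 - X. By linearity it is
    enough to have L((1 + X)^n) = (-1)^n b_n for all n, by strong induction.
    For even n, (1 + X)^n - X^n has degree < n and is anti-invariant, so L
    kills it. For odd n >= 3, the recurrence, which reads
    L((1 + X)^n) + b_n = - (L((1 + X)^(n-1)) - b_(n-1)) / 2, has a vanishing
    right-hand side; n = 1 holds by the choice of initial values. *)

(* Truncating at degree N makes linearity immediate. *)
Definition moment (b : nat -> rat) (N : nat) (p : {poly rat}) : rat :=
  \sum_(i < N) p`_i * b i.

Lemma moment_is_linear b N : linear_for *%R (moment b N).
Proof.
move=> c p q; rewrite /moment mulr_sumr -big_split /=; apply: eq_bigr => i _.
by rewrite coefD coefZ mulrDl mulrA.
Qed.

HB.instance Definition _ b N :=
  GRing.isLinear.Build rat {poly rat} rat *%R (moment b N) (@moment_is_linear b N).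

Lemma momentXn b N k : (k < N)%N -> moment b N 'X^k = b k.
Proof.
move=> ltkN; rewrite /moment (bigD1 (Ordinal ltkN)) //= coefXn eqxx mul1r.
rewrite big1 ?addr0 // => i; rewrite -val_eqE /= => /negPf neq.
by rewrite coefXn neq mul0r.
Qed.

Lemma momentXnD1Xn b N j m : (j + m < N)%N ->
  moment b N ('X^j * (1 + 'X) ^+ m) = \sum_(i < m.+1) 'C(m, i)%:R * b (j + i).
Proof.
move=> ltN; rewrite exprDn mulr_sumr raddf_sum; apply: eq_bigr => i _ /=.
rewrite expr1n mul1r mulrnAr -exprD -scaler_nat linearZ /= momentXn //.
by rewrite (leq_ltn_trans _ ltN) // leq_add2l -ltnS.
Qed.

(** Checked on monomials: X^i goes to (-1)^i (1 + X)^i, whose sign cancels the one in the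
    hypothesis. Only exponents below [n] are assumed, so this is usable inside the strong
    induction. *)
Lemma moment_refl_lt b N n (p : {poly rat}) : (size p <= n)%N -> (n <= N)%N ->
    (forall k, (k < n)%N -> moment b N ((1 + 'X) ^+ k) = (-1) ^+ k * b k) ->
  moment b N (p \Po (- (1 + 'X))) = moment b N p.
Proof.
move=> szp leN Hk.
rewrite -[p](take_poly_id szp) /take_poly poly_def.
rewrite !raddf_sum; apply: eq_bigr => i _ /=.
rewrite comp_polyZ comp_Xn_poly !linearZ /= momentXn ?(leq_trans (ltn_ord i)) //.
congr (_ * _); rewrite exprNn -polyCN -polyC_exp mul_polyC linearZ /= Hk //.
by rewrite mulrA -exprMn mulrNN mulr1 expr1n mul1r.
Qed.

(** The involution swaps X and 1 + X up to sign, since 1 - (1 + X) = -X. *)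
Lemma refl_XnD1Xn i m :
  ('X^i * (1 + 'X) ^+ m : {poly rat}) \Po (- (1 + 'X)) =
  (-1) ^+ (i + m) *: ('X^m * (1 + 'X) ^+ i).
Proof.
rewrite comp_polyM !rmorphXn /= comp_polyX comp_polyD comp_polyX.
have -> : 1 \Po (- (1 + 'X)) + - (1 + 'X) = - 'X :> {poly rat}.
  by rewrite -{1}[1]/(1%:P) comp_polyC opprD addNKr.
rewrite [(- (1 + 'X)) ^+ i]exprNn [(- 'X) ^+ m]exprNn mulrACA -exprD
  [in RHS]mulrC.
by rewrite -mul_polyC polyC_exp polyCN.
Qed.

Definition scaled_aG (a : int) (k : nat) : rat := 2 ^- k * aG a k.

Lemma cG_moment a N j d : (j <= d)%N -> (d < N)%N ->
  cG a j d = moment (scaled_aG a) N ('X^j * (1 + 'X) ^+ (d - j)).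
Proof.
move=> lejd ltdN; rewrite momentXnD1Xn ?subnKC // /cG -{1}[j]add0n big_addn.
rewrite subSn // big_mkord; apply: eq_bigr => i _.
have lei : (i <= d - j)%N by rewrite -ltnS.
(* With k = j + i, symmetry turns C(d - j, d - k) into C(d - j, i). *)
by rewrite addnC subnDA bin_sub // /scaled_aG mulrAC mulrC mulrA.
Qed.

(** The subtracted b_n is the top term k = n of L((1 + X)^n), absent from the sum. *)
Lemma moment_D1Xn_sub a N n : (n < N)%N ->
  \sum_(0 <= k < n) aG a k * 'C(n, k)%:R * 2 ^+ (n - k) =
  2 ^+ n * (moment (scaled_aG a) N ((1 + 'X) ^+ n) - scaled_aG a n).
Proof.
move=> ltnN; rewrite -[(1 + 'X) ^+ n]mul1r (@momentXnD1Xn _ N 0) //.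
rewrite big_ord_recr /= binn mul1r addrK big_mkord mulr_sumr.
apply: eq_bigr => k _; rewrite /scaled_aG exprB ?unitfE // 1?ltnW //.
by ring.
Qed.

Lemma aG_rec_moment a N n : (3 <= n)%N -> (n < N)%N ->
  moment (scaled_aG a) N ((1 + 'X) ^+ n) + scaled_aG a n =
  - (moment (scaled_aG a) N ((1 + 'X) ^+ n.-1) - scaled_aG a n.-1) / 2.
Proof.
case: n => // n n3 ltN; have := aG_rec a n3.
rewrite succnK (@moment_D1Xn_sub a N n) ?(ltnW ltN) // (@moment_D1Xn_sub a N n.+1) //.
have -> : aG a n.+1 = 2 ^+ n.+1 * scaled_aG a n.+1.
  by rewrite /scaled_aG mulrA divff ?mul1r // expf_neq0.
set S := moment _ _ _; set S' := moment _ _ _.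
rewrite exprS => E; have t0 : (2 : rat) ^+ n != 0 by rewrite expf_neq0.
(* Multiplied by [t], the goal is linear in products that [lra] takes as atoms. *)
apply: (mulfI t0); move: E; set t := 2 ^+ n; lra.
Qed.

Lemma size_D1Xn_subXn n : (size (((1 + 'X) ^+ n - 'X^n)%R : {poly rat}) <= n)%N.
Proof.
rewrite exprDn big_ord_recr /= subnn expr0 mul1r binn mulr1n addrK.
apply: (leq_trans (size_sum _ _ _)); apply/bigmax_leqP => i _.
rewrite expr1n mul1r -scaler_nat.
by rewrite (leq_trans (size_scale_leq _ _)) // size_polyXn.
Qed.

Lemma moment_D1Xn a N n : (n < N)%N ->
  moment (scaled_aG a) N ((1 + 'X) ^+ n) = (-1) ^+ n * scaled_aG a n.
Proof.
elim/ltn_ind: n => n IH ltnN; case: (boolP (odd n)) => oddn.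
  have [n3|] := leqP 3 n; last first.
    (* Only n = 1 remains: b_0 + b_1 = 1 - 1/2 = -b_1. *)
    case: n oddn ltnN {IH} => [|[|[|]]] // _ ltnN.
    rewrite expr1 raddfD /= (@momentXn _ N 0) ?(ltnW ltnN) //.
    by rewrite -['X]expr1 momentXn.
  case: n n3 oddn ltnN IH => // n n3 /= /negPf oddn ltnN IH.
  have := @aG_rec_moment a N n.+1 n3 ltnN; rewrite succnK (IH n) // 1?ltnW //.
  by rewrite [(-1) ^+ n.+1]exprS -signr_odd oddn expr0; lra.
have: moment (scaled_aG a) N ((1 + 'X) ^+ n - 'X^n) = 0.
  set p := _ - _; suff: moment (scaled_aG a) N p = - moment (scaled_aG a) N p by lra.
  rewrite -raddfN /= -(@moment_refl_lt _ N n p) ?size_D1Xn_subXn 1?ltnW //; last first.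
    by move=> k ltkn; rewrite IH // (ltn_trans ltkn).
  (* These two instances swap X^n and (1 + X)^n, without sign as [n] is even, so [p] goes to
     [- p]. *)
  have := refl_XnD1Xn n 0; have := refl_XnD1Xn 0 n.
  rewrite !expr0 !mul1r !mulr1 addn0 -signr_odd (negPf oddn) expr0 !scale1r.
  by rewrite /p comp_polyB => -> ->; rewrite opprB.
by rewrite raddfB /= momentXn // -signr_odd (negPf oddn) expr0 mul1r => /subr0_eq.
Qed.

Theorem mainTheorem13 (a : int) (ha : a <= -1) (d j : nat) (hj : (j <= d)%N) :
  cG a j d = (-1) ^+ d * cG a (d - j) d.
Proof.
rewrite !(@cG_moment a d.+1) ?leq_subr // subKn //.
rewrite -(@moment_refl_lt _ d.+1 d.+1 ('X^j * _)) //; last first.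
- by move=> k ltk; rewrite moment_D1Xn.
(* Written as X - (-1), the factor has powers of known size, and the product has degree at most
   d. *)
- have -> : 1 + 'X = 'X - (-1)%:P :> {poly rat} by rewrite polyCN opprK addrC.
  rewrite (leq_trans (size_polyMleq _ _)) // size_polyXn size_exp_XsubC /=.
  by rewrite addnS subnKC.
by rewrite refl_XnD1Xn subnKC // linearZ.
Qed.
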